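(* Let $(H,X,\mathcal L,A,B=P+Q)$ and $(\widehat H,\widehat X,\widehat{\mathcal L},\widehat A,\widehat B=\widehat P+\widehat Q)$ be two tuples with $\mathcal L:H\to\mathbb R$, $A:X\to X$, $B:X\to L_s(H)$ (and similarly for the second), each of which becomes admissible (see context) after restriction to some open neighborhood $V$ (resp. $\widehat V$) of the origin. Suppose $J:H\to\widehat H$ is a linear injection such that $$(Ju,Jv)_{\widehat H}=(u,v)_H\ \ \forall u,v\in H,\qquad J(X)\subset\widehat X,\quad J|_X\in L(X,\widehat X),\qquad \widehat{\mathcal L}\circ J=\mathcal L,$$ $$\widehat A(J(x))=J\circ A(x)\quad\text{and}\quad\widehat B(J(x))\circ J=J\circ B(x)\qquad\forall x\in X.$$ If $\dim H^-=\dim\widehat H^-$, then for the continuous maps $h:B_{H^0}(\theta,\epsilon)\to X^\pm$, $\hat h:B_{\widehat H^0}(\theta,\epsilon)\to\widehat X^\pm$ and the origin-preserving homeomorphisms $$\Phi:B_{H^0}(\theta,\epsilon)\times(B_{H^+}(\theta,\epsilon)+B_{H^-}(\theta,\epsilon))\to W,\qquad\widehat\Phi:B_{\widehat H^0}(\theta,\epsilon)\times(B_{\widehat H^+}(\theta,\epsilon)+B_{\widehat H^-}(\theta,\epsilon))\to\widehat W$$ constructed as in the context (with common, sufficiently small radii), it holds that $$\hat h(Jz)=J\circ h(z)\quad\text{and}\quad\widehat\Phi(Jz,Ju^++Ju^-)=J\circ\Phi(z,u^++u^-)$$ for all $(z,u^+,u^-)\in B_{H^0}(\theta,\epsilon)\times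 B_{H^+}(\theta,\epsilon)\times B_{H^-}(\theta,\epsilon)$. Consequently, $$\widehat{\mathcal L}\circ\widehat\Phi(Jz,Ju^++Ju^-)=\mathcal L\circ\Phi(z,u^++u^-),\qquad\widehat{\mathcal L}(Jz+\hat h(Jz))=\mathcal L(z+h(z))$$ for all such $(z,u^+,u^-)$. (If $\dim H^-=0$ or $\dim H^0=0$ the corresponding factor is omitted.)
   Context: Conventions. All vector spaces are real; $\theta$ denotes the origin of any of them. $B_E(\theta,r)$, $\bar B_E(\theta,r)$ are the open and closed balls of a normed space $E$; subspaces of $H$ carry the norm of $H$. $L_s(H)\subset L(H)$ is the space of bounded self-adjoint operators. A map $T:U\to E_2$ on an open subset $U$ of a normed space $E_1$ is continuously directional differentiable on $U$ if $DT(x,u)=\lim_{t\to0}(T(x+tu)-T(x))/t$ exists for all $x\in U$, $u\in E_1$ and $(x,u)\mapsto DT(x,u)$ is continuous on $U\times E_1$ (then $DT(x):=DT(x,\cdot)$ is bounded linear). $T$ is strictly Fréchet differentiable at $x_0$ if there is $T'(x_0)\in L(E_1,E_2)$ with $\|T(x)-T(y)-T'(x_0)(x-y)\|=o(\|x-y\|)$ as $x\to x_0$, $y\to x_0$. A critical point is a point where the (Gâteaux) derivative vanishes. Admissible tuple. $(H,X,V,\mathcal L,A,B,P,Q)$ is admissible if: (S) $H$ is a Hilbert space with inner product $(\cdot,\cdot)_H$ and norm $\|\cdot\|$; $X$ is a Banach space with norm $\|\cdot\|_X$; $X\subset H$ is a dense linear subspace and $\|x\|\le\|x\|_X$ for $x\in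 X$. $V$ is an open neighborhood of $\theta$ in $H$; $V^X:=V\cap X$ regarded as an open subset of $X$. (F1) $\mathcal L:V\to\mathbb R$ is continuously directional differentiable on $V$. (F2) $A:V^X\to X$ is continuously directional differentiable, strictly Fréchet differentiable at $\theta$, and $D\mathcal L(x)(u)=(A(x),u)_H$ for all $x\in V^X$, $u\in X$. (F3) $B:V^X\to L_s(H)$ is a map with $(DA(x)(u),v)_H=(B(x)u,v)_H$ for all $x\in V^X$, $u,v\in X$. (C1) $\theta$ is a critical point of $\mathcal L|_{V^X}$ (and thus of $\mathcal L$), and $0$ is either not in the spectrum $\sigma(B(\theta))$ or is an isolated point of it. (C2) If $u\in H$ and $B(\theta)u\in X$, then $u\in X$. (D) $B(x)=P(x)+Q(x)$ for all $x\in V^X$, where $P(x):H\to H$ is a positive definite linear operator and $Q(x):H\to H$ is a compact linear operator, with: (D1) all eigenvectors of $B(\theta)$ belonging to negative eigenvalues lie in $X$; (D2) for any sequence $\{x_k\}\subset V\cap X$ with $\|x_k\|\to0$, $\|P(x_k)u-P(\theta)u\|\to0$ for every $u\in H$; (D3) $Q:V\cap X\to L(H)$ is continuous at $\theta$ with respect to the topology on $V\cap X$ induced from $H$; (D4) for any sequence $\{x_n\}\subset V\cap X$ with $\|x_n\|\to0$ there exist $C_0>0$ and $n_0\in\mathbb N$ with $(P(x_n)u,u)_H\ge C_0\|u\|^2$ for all $u\in H$, $n\ge n_0$. Notation. $H^0=\mathrm{Ker}(B(\theta))$, $H^\pm=(H^0)^\perp$, and $H=H^0\oplus H^+\oplus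 H^-$ orthogonally, with $H^+$, $H^-$ invariant under $B(\theta)$ and $B(\theta)$ positive definite on $H^+$, negative definite on $H^-$. $H^0$ and $H^-$ are finite dimensional and contained in $X$. $P^0$ is the orthogonal projection onto $H^0$; $X^\pm=X\cap H^\pm$. Hats denote the corresponding objects of the second tuple. Construction of $h$ and $\Phi$. For small radius, $h:B_{H^0}(\theta,\epsilon)\to X^\pm$ is the unique Lipschitz continuous map with $h(\theta)=\theta$ and $(I-P^0)A(z+h(z))=\theta$. For small $\delta>0$ put $F(z,u)=\mathcal L(z+h(z)+u)-\mathcal L(z+h(z))$ for $z\in H^0$, $u\in H^\pm$ near $\theta$. For sufficiently small $\epsilon_1\in(0,\delta)$, for each small $z\in H^0$ and each $x^+\in B_{H^+}(\theta,\epsilon_1)$ there is a unique $\varphi_z(x^+)\in B_{H^-}(\theta,\delta)$ with $F(z,x^++\varphi_z(x^+))=\max\{F(z,x^++x^-):x^-\in B_{H^-}(\theta,\delta)\}$. Define $$\psi(z,x^++x^-)=\sqrt{F(z,x^++\varphi_z(x^+))}\,\frac{x^+}{\|x^+\|}+\sqrt{F(z,x^++\varphi_z(x^+))-F(z,x^++x^-)}\,\frac{x^--\varphi_z(x^+)}{\|x^--\varphi_z(x^+)\|}$$ for $x^+\in B_{H^+}(\theta,\epsilon_1)$, $x^-\in B_{H^-}(\theta,\delta)$, where a summand is replaced by $\theta$ if its denominator vanishes. For each $z$ the map $\psi(z,\cdot)$ is injective and, for $\epsilon$ small, its image contains $B_{H^+}(\theta,\epsilon)+B_{H^-}(\theta,\epsilon)$;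 $\phi_z(u)$ denotes the unique preimage of $u$ under $\psi(z,\cdot)$, and $\Phi(z,u^++u^-)=z+h(z)+\phi_z(u^++u^-)$. The radii $\delta,\epsilon_1,\epsilon$ are taken the same for both tuples. *)

(* Defs.v *)
From HB Require Import structures.
From mathcomp Require Import all_boot all_order all_algebra.
From mathcomp Require Import all_classical all_reals all_analysis.
Import Order.TTheory GRing.Theory Num.Theory.
Import numFieldNormedType.Exports.

Set Implicit Arguments.
Unset Strict Implicit.
Unset Printing Implicit Defensive.

Local Open Scope classical_set_scope.
Local Open Scope ring_scope.

Section Differentiability.
Context {R : realType} {E1 E2 : normedModType R}.

(* [T] is total; only its germ at points of [U] matters when [U] is open. *)
Definition cont_dir_differentiable (U : set E1) (T : E1 -> E2) : Prop :=
  (forall x u, U x -> derivable T x u) /\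
  (forall x u, U x -> {for (x, u), continuous (fun p : E1 * E1 => 'D_(p.2) T p.1)}).

Definition strictly_differentiable (T : E1 -> E2) (x0 : E1) : Prop :=
  exists2 T' : {linear E1 -> E2}, continuous T' &
    forall e : R, 0 < e -> \forall x \near x0 & y \near x0,
      `|T x - T y - T' (x - y)| <= e * `|x - y|.

End Differentiability.

Section HilbertSpace.
Context {R : realType} {H : completeNormedModType R} (ip : {dot H for idfun}).

(* With this, the complete normed space [H] is a Hilbert space for [ip]. *)
Definition norm_of_dot : Prop := forall u, ip u u = `|u| ^+ 2.

Definition compact_operator (T : H -> H) : Prop :=
  precompact (T @` [set u | `|u| <= 1]).

(* The space L_s(H). *)
Record sa_operator := SAOperator {
  sa_op :> {linear H -> H};
  sa_continuous : continuous sa_op;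
  sa_symmetric : forall u v, ip (sa_op u) v = ip u (sa_op v)
}.

Definition spectrum (T : H -> H) : set R :=
  [set l | ~ exists S : {linear H -> H},
     [/\ continuous S, cancel (fun u => T u - l *: u) S
       & cancel S (fun u => T u - l *: u)]].

Definition is_subspace (E : set H) : Prop :=
  E 0 /\ forall (a : R) u v, E u -> E v -> E (a *: u + v).

Definition has_dim (E : set H) (n : nat) : Prop :=
  exists2 f : {linear 'rV[R]_n -> H}, injective f & range f = E.

Definition orthocomp (E : set H) : set H := [set u | forall v, E v -> ip u v = 0].

(* Orthogonal projection onto [E]; it is only used for [E] a closed subspace,
   where the defining set is a singleton. *)
Definition oproj (E : set H) (u : H) : H :=
  xget 0 [set v | E v /\ orthocomp E (u - v)].

Definition subball (E : set H) (r : R) : set H := E `&` [set u | `|u| < r].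

Definition ball_sum (E1 E2 : set H) (r1 r2 : R) : set H :=
  [set u1 + u2 | u1 in subball E1 r1 & u2 in subball E2 r2].

Definition ker_op (T : H -> H) : set H := [set u | T u = 0].

Definition positive_on (E : set H) (T : H -> H) : Prop :=
  forall u, E u -> u != 0 -> 0 < ip (T u) u.

Definition negative_on (E : set H) (T : H -> H) : Prop :=
  forall u, E u -> u != 0 -> ip (T u) u < 0.

(* H = Ker T + Hp + Hm is the decomposition H^0 + H^+ + H^- attached to T. *)
Record spectral_splitting (T : H -> H) (Hp Hm : set H) : Prop := {
  split_subp : is_subspace Hp;
  split_subm : is_subspace Hm;
  split_orthp : Hp `<=` orthocomp (ker_op T);
  split_orthm : Hm `<=` orthocomp (ker_op T);
  split_orthpm : Hp `<=` orthocomp Hm;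
  split_sum : forall u, exists u0 up um,
    [/\ ker_op T u0, Hp up, Hm um & u = u0 + up + um];
  split_invp : T @` Hp `<=` Hp;
  split_invm : T @` Hm `<=` Hm;
  split_posp : positive_on Hp T;
  split_negm : negative_on Hm T
}.

End HilbertSpace.

Section Tuple.
Context {R : realType} {H X : completeNormedModType R}.
Variables (ip : {dot H for idfun}) (i : {linear X -> H}).

(* The Banach space [X], with its own norm, is a subspace of [H] through the
   injection [i], so that [i @^-1` V] is V^X.  The maps are total; only their
   values on [V], resp. [i @^-1` V], are constrained. *)
Record admissible (V : set H) (L : H -> R) (A : X -> X) (B : X -> sa_operator ip)
    (P Q : X -> {linear H -> H}) : Prop := {
  adm_S_dot : norm_of_dot ip;
  adm_S_inj : injective i;
  adm_S_dense : dense (range i);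
  adm_S_norm : forall x, `|i x| <= `|x|;
  adm_S_open : open V;
  adm_S_0 : V 0;
  adm_F1 : cont_dir_differentiable V L;
  adm_F2_diff : cont_dir_differentiable (i @^-1` V) A;
  adm_F2_strict : strictly_differentiable A 0;
  adm_F2_grad : forall x u, V (i x) -> 'D_(i u) L (i x) = ip (i (A x)) (i u);
  adm_F3 : forall x u v, V (i x) ->
    ip (i ('D_u A x)) (i v) = ip (B x (i u)) (i v);
  adm_C1_crit : forall u : X, 'D_u (L \o i) 0 = 0;
  adm_C1_spec : ~ spectrum (B 0) 0 \/ isolated (spectrum (B 0)) 0;
  adm_C2 : forall u, range i (B 0 u) -> range i u;
  adm_D : forall x u, V (i x) -> B x u = P x u + Q x u;
  adm_D_pos : forall x, V (i x) -> positive_on ip setT (P x);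
  adm_D_cpt : forall x, V (i x) -> compact_operator (Q x);
  adm_D1 : forall (l : R) u, l < 0 -> u != 0 -> B 0 u = l *: u -> range i u;
  adm_D2 : forall x : nat -> X, (forall k, V (i (x k))) ->
    (fun k => `|i (x k)|) @ \oo --> 0 ->
    forall u, (fun k => `|P (x k) u - P 0 u|) @ \oo --> 0;
  (* continuity at 0 for the norm of [H] on the source and the operator norm *)
  adm_D3 : forall e : R, 0 < e -> exists2 d : R, 0 < d &
    forall x, V (i x) -> `|i x| < d -> forall u, `|Q x u - Q 0 u| <= e * `|u|;
  adm_D4 : forall x : nat -> X, (forall k, V (i (x k))) ->
    (fun k => `|i (x k)|) @ \oo --> 0 ->
    exists (C0 : R) (n0 : nat), 0 < C0 /\
      forall u n, (n0 <= n)%N -> C0 * `|u| ^+ 2 <= ip (P (x n) u) u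
}.

Variables (L : H -> R) (A : X -> X) (T : H -> H) (Hp Hm : set H).

Local Notation H0 := (ker_op T).

(* H^0 lies in X, so the points [i x] in the last field are all of B_{H^0}(0, eps).
   Lipschitz: from the norm of [H] to the norm of [X]. *)
Record is_h (eps : R) (h : H -> X) : Prop := {
  h_lipschitz : [lipschitz h z | z in subball H0 eps];
  h_0 : h 0 = 0;
  h_Xpm : forall z, subball H0 eps z -> orthocomp ip H0 (i (h z));
  h_eq : forall x : X, subball H0 eps (i x) ->
    i (A (x + h (i x))) - oproj ip H0 (i (A (x + h (i x)))) = 0
}.

Definition Ffun (h : H -> X) (z u : H) : R :=
  L (z + i (h z) + u) - L (z + i (h z)).

(* [vphi z xp] is the unique maximizer varphi_z(x^+). *)
Definition is_vphi (delta eps1 eps : R) (h : H -> X) (vphi : H -> H -> H) : Prop :=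
  forall z xp, subball H0 eps z -> subball Hp eps1 xp ->
    let maximizer := [set y | subball Hm delta y /\
      forall xm, subball Hm delta xm -> Ffun h z (xp + xm) <= Ffun h z (xp + y)] in
    maximizer (vphi z xp) /\ forall y, maximizer y -> y = vphi z xp.

(* Since [`|0|^-1 = 0], a summand whose denominator vanishes is 0. *)
Definition psi (h : H -> X) (vphi : H -> H -> H) (z x : H) : H :=
  let xp := oproj ip Hp x in
  let xm := oproj ip Hm x in
  let y := vphi z xp in
  (Num.sqrt (Ffun h z (xp + y)) / `|xp|) *: xp
  + (Num.sqrt (Ffun h z (xp + y) - Ffun h z (xp + xm)) / `|xm - y|) *: (xm - y).

(* [phi z u] is the unique preimage phi_z(u) of [u] under psi(z, .). *)
Definition is_phi (delta eps1 eps : R) (h : H -> X) (vphi phi : H -> H -> H) : Prop :=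
  forall z u, subball H0 eps z -> ball_sum Hp Hm eps eps u ->
    let preimage := [set x | ball_sum Hp Hm eps1 delta x /\ psi h vphi z x = u] in
    preimage (phi z u) /\ forall x, preimage x -> x = phi z u.

Record construction (delta eps1 eps : R)
    (h : H -> X) (vphi phi : H -> H -> H) : Prop := {
  constr_h : is_h eps h;
  constr_vphi : is_vphi delta eps1 eps h vphi;
  constr_phi : is_phi delta eps1 eps h vphi phi
}.

Definition Phi (h : H -> X) (phi : H -> H -> H) (z u : H) : H :=
  z + i (h z) + phi z u.

End Tuple.

(* Main.v *)
(* [J] need not map [H^0] onto the kernel of the second operator, so uniqueness of
   [h], of the maximizers [varphi_z] and of the preimages [phi_z] is used on the
   second side only, after transporting the objects of the first side by [J].

   That [J] respects the splittings: [J (H^0)] lies in the kernel since [J]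
   intertwines [B(0)]; [J (H^+ + H^-)] lies in its orthogonal complement since
   [H^+ + H^-] is the range of [B(0)] ([B(0)] is a compact perturbation of a
   coercive operator, hence bounded below off its kernel); [J (H^-)] lies in [H^-]
   because [I + t B(0)] contracts a negative invariant subspace and expands a
   positive one; equality of dimensions then gives [J (H^-) = H^-], and [J (H^+)]
   lies in [H^+] by orthogonality.

   The map [h] is only given as some Lipschitz solution of [(I - P^0) A(z + h(z)) = 0].
   The inverse of [B(0)] off its kernel maps [X] to [X] by (C2), continuously by the
   closed graph theorem, so strict differentiability makes solutions near 0 unique;
   continuity of [h] along the segments [t z] keeps [h(z)] in that neighborhood,
   uniformly in the Lipschitz constant. *)

From HB Require Import structures.
Require Import Defs.
From mathcomp Require Import all_boot all_order all_algebra.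
From mathcomp Require Import all_classical all_reals all_analysis.
From mathcomp Require Import ring lra.
Import Order.TTheory GRing.Theory Num.Theory.
Import numFieldNormedType.Exports.

Set Implicit Arguments.
Unset Strict Implicit.
Unset Printing Implicit Defensive.

Local Open Scope classical_set_scope.
Local Open Scope ring_scope.

(** * Inner products *)

Section InnerProduct.
Context {R : realType} {H : completeNormedModType R} (ip : {dot H for idfun}).
Hypothesis ip_norm : norm_of_dot ip.

Lemma ip_sym u v : ip u v = ip v u.
Proof. by rewrite hermC/= expr0 mul1r. Qed.

Lemma ip_Dl u v w : ip (u + v) w = ip u w + ip v w.
Proof. exact: linearDl. Qed.
Lemma ip_Dr u v w : ip w (u + v) = ip w u + ip w v.
Proof. exact: linearDr. Qed.
Lemma ip_Nl u w : ip (- u) w = - ip u w.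
Proof. exact: linearNl. Qed.
Lemma ip_Nr u w : ip w (- u) = - ip w u.
Proof. exact: linearNr. Qed.
Lemma ip_Zl (a : R) u w : ip (a *: u) w = a * ip u w.
Proof. exact: linearZl_LR. Qed.
Lemma ip_Zr (a : R) u w : ip w (a *: u) = a * ip w u.
Proof. by rewrite ip_sym ip_Zl ip_sym. Qed.
Lemma ip_0l w : ip 0 w = 0.
Proof. exact: linear0l. Qed.
Lemma ip_0r w : ip w 0 = 0.
Proof. exact: linear0r. Qed.

Definition ipE := (ip_Dl, ip_Dr, ip_Nl, ip_Nr, ip_Zl, ip_Zr, ip_0l, ip_0r).

Lemma ip_self0 u : ip u u = 0 -> u = 0.
Proof. by rewrite ip_norm => /eqP; rewrite sqrf_eq0 normr_eq0 => /eqP. Qed.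

Lemma sqr_normD u v : `|u + v| ^+ 2 = `|u| ^+ 2 + 2 * ip u v + `|v| ^+ 2.
Proof. by rewrite -!ip_norm !ipE (ip_sym v u); ring. Qed.

(** The form of [T] at [a *: u + v] is a nonnegative quadratic polynomial in [a], so its
    discriminant is nonpositive. The identity gives the usual inequality; an operator semidefinite
    on a subspace gives the estimate behind [positive_contraction]. *)
Lemma psd_CauchySchwarz (T : {linear H -> H}) (E : set H) u v :
  (forall u v, ip (T u) v = ip u (T v)) -> is_subspace E ->
  (forall w, E w -> 0 <= ip (T w) w) -> E u -> E v ->
  ip (T u) v ^+ 2 <= ip (T u) u * ip (T v) v.
Proof.
move=> Tsym [E0 Elin] Tge0 Eu Ev.
have q (a : R) : 0 <= a ^+ 2 * ip (T u) u + 2 * a * ip (T u) v + ip (T v) v.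
  have := Tge0 _ (Elin a _ _ Eu Ev); rewrite (linearP T) !ipE.
  by rewrite (Tsym v u) (ip_sym v); lra.
have uu := Tge0 _ Eu; have [uu0|uun0] := eqVneq (ip (T u) u) 0.
  rewrite uu0 mul0r; have [->|x0] := eqVneq (ip (T u) v) 0; first by rewrite expr0n.
  (* Without the quadratic term [q] is affine with nonzero slope; at this point it equals -1. *)
  have := q (- (ip (T v) v + 1) / (2 * ip (T u) v)); rewrite uu0 mulr0 add0r.
  have -> : 2 * (- (ip (T v) v + 1) / (2 * ip (T u) v)) * ip (T u) v =
    - (ip (T v) v + 1) by field.
  by move=> ?; exfalso; lra.
have uup : 0 < ip (T u) u by rewrite lt_neqAle eq_sym uun0.
(* This is the minimizer of the quadratic polynomial. *)
have := q (- ip (T u) v / ip (T u) u); set a := ip _ u; set b := ip _ v; set c := ip (T v) v.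
have -> : (- b / a) ^+ 2 * a + 2 * (- b / a) * b + c = (a * c - b ^+ 2) / a.
  by field.
by rewrite pmulr_lge0 ?invr_gt0// subr_ge0.
Qed.

Lemma ip_CauchySchwarz u v : `|ip u v| <= `|u| * `|v|.
Proof.
rewrite -(@ler_pXn2r _ 2)// ?nnegrE ?mulr_ge0// exprMn -!ip_norm.
rewrite real_normK ?num_real//.
apply: (@psd_CauchySchwarz idfun setT) => // w _ /=; last by rewrite ip_norm sqr_ge0.
Qed.

Lemma continuous_ip v : continuous (ip ^~ v).
Proof.
move=> x; apply/cvgrPdist_lt => e e0.
have v1 : 0 < `|v| + 1 by rewrite ltr_wpDl.
near=> y; rewrite -ip_Nl -ip_Dl (le_lt_trans (ip_CauchySchwarz _ _))//.
rewrite (@le_lt_trans _ _ (`|x - y| * (`|v| + 1)))//.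
  by rewrite ler_wpM2l// lerDl.
by rewrite -ltr_pdivlMr//; near: y; apply: cvgr_dist_lt => //; rewrite divr_gt0.
Unshelve. all: by end_near. Qed.

Lemma closed_orthocomp E : closed (orthocomp ip E).
Proof.
rewrite [X in closed X](_ : _ = \bigcap_(v in E) ((ip ^~ v) @^-1` [set 0])); last first.
  by rewrite predeqE => u; split => h v; apply: h.
apply: closed_bigI => v _; apply: closed_comp => [x _|]; first exact: continuous_ip.
exact: closed_eq.
Qed.

Lemma subspace_orthocomp E : is_subspace (orthocomp ip E).
Proof.
split=> [v _|a u v hu hv w Ew]; first by rewrite ip_0l.
by rewrite !ipE hu// hv// mulr0 addr0.
Qed.

Lemma orthocomp_disj E u : E u -> orthocomp ip E u -> u = 0.
Proof. by move=> Eu /(_ _ Eu)/ip_self0. Qed.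

Lemma oprojE E u v : is_subspace E -> E v -> orthocomp ip E (u - v) ->
  oproj ip E u = v.
Proof.
move=> [E0 Elin] Ev ov; apply: xget_unique => // w [Ew ow].
apply/eqP; rewrite -subr_eq0; apply/eqP/(@orthocomp_disj E).
  by rewrite addrC -scaleN1r; apply: Elin.
have -> : w - v = (-1) *: (u - w) + (u - v).
  by rewrite scaleN1r opprB addrA subrK.
exact: (subspace_orthocomp E).2.
Qed.

End InnerProduct.

(** * Operators bounded below *)

Lemma continuous_linear_bound {R : realType} {V W : normedModType R}
    (f : {linear V -> W}) :
  continuous f -> exists2 M : R, 0 < M & forall x, `|f x| <= M * `|x|.
Proof.
move=> /linear_bounded_continuous/linear_boundedP/pinfty_ex_gt0[M M0 fM].
by exists M.
Qed.

Section Operators.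
Context {R : realType} {H : completeNormedModType R} (ip : {dot H for idfun}).
Hypothesis ip_norm : norm_of_dot ip.

(* Take unit vectors on which [T] tends to 0 and, by compactness, [Q] converges:
   coercivity of [P = T - Q] makes them a Cauchy filter, whose limit would be a
   unit vector in the kernel of [T]. *)
Lemma fredholm_bounded_below (T P Q : {linear H -> H}) (C : R) (E : set H) :
  continuous T -> (forall u, T u = P u + Q u) ->
  0 < C -> (forall u, C * `|u| ^+ 2 <= ip (P u) u) -> compact_operator Q ->
  closed E -> is_subspace E -> (forall u, E u -> T u = 0 -> u = 0) ->
  exists2 c : R, 0 < c & forall u, E u -> c * `|u| <= `|T u|.
Proof.
move=> Tcont TPQ C0 Pcoer [K QK [Kcpt _]] Ecl [E0 Elin] Tinj.
pose S (e : R) := [set u | [/\ E u, `|u| = 1 & `|T u| < e]].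
have [[e e0 Se]|Sn0] := pselect (exists2 e, 0 < e & forall u, ~ S e u).
  exists e => // u Eu; have [->|u0] := eqVneq u 0.
    by rewrite normr0 mulr0.
  have nu0 : 0 < `|u| by rewrite normr_gt0.
  rewrite leNgt; apply/negP => Tu; apply: (Se (`|u|^-1 *: u)); split.
  - by rewrite -[_ *: _]addr0; apply: Elin.
  - by rewrite normrZ ger0_norm ?invr_ge0// mulVf// gt_eqF.
  - by rewrite linearZ normrZ ger0_norm ?invr_ge0// mulrC ltr_pdivrMr.
have {}Sn0 e : 0 < e -> S e !=set0.
  move=> e0; apply/set0P/eqP => Se; apply: Sn0; exists e => // u.
  by rewrite Se.
pose F := filter_from [set e : R | 0 < e] S.
have FF : ProperFilter F.
  apply: filter_from_proper => //.
  apply: filter_from_filter; first by exists 1; rewrite /= ltr01.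
  move=> a b /= a0 b0; exists (Num.min a b); first by rewrite /= lt_min a0.
  move=> u [Eu u1]; rewrite lt_min => /andP[Tua Tub].
  by split; split.
have QFK : (Q @ F) K.
  by exists 1 => //= u [_ u1 _]; apply: QK; exists u => //=; rewrite u1.
have [w [_ Qw]] := Kcpt _ _ QFK.
(* [w] is a cluster point of [Q] along [F], so the sets [S'] are nonempty and generate a filter on
   which [Q] also converges. *)
pose S' (e : R) := S e `&` [set u | `|w - Q u| < e].
have S'n0 e : 0 < e -> S' e !=set0.
  move=> e0; have [||_ [[u Su <-] wu]] := Qw (Q @` S e) [set v | `|w - v| < e].
  - by exists e => // u Su; exists u.
  - by apply/nbhs_normP; exists e.
  - by exists u.
pose G := filter_from [set e : R | 0 < e] S'.
have GF : ProperFilter G.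
  apply: filter_from_proper => //.
  apply: filter_from_filter; first by exists 1; rewrite /= ltr01.
  move=> a b /= a0 b0; exists (Num.min a b); first by rewrite /= lt_min a0.
  move=> u [[Eu u1]]; rewrite /= !lt_min => /andP[Tua Tub] /andP[Qua Qub].
  by split; split.
have GS' e : 0 < e -> G (S' e) by move=> e0; exists e.
have Gcauchy : cauchy G.
  apply/cauchy_ballP => e e0.
  (* [P (u - v)] is a signed sum of four terms, each below this bound, hence has norm below [C * e];
     coercivity then gives [|u - v| < e]. *)
  have d0 : 0 < C * e / 4 by rewrite divr_gt0// mulr_gt0.
  exists (S' (C * e / 4), S' (C * e / 4)) => [|[u v] /=]; first by split; exact: GS'.
  move=> [[[_ _ /= Tu] /= Qu] [[_ _ /= Tv] /= Qv]]; rewrite -ball_normE /=.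
  rewrite ltNge; apply/negP => euv.
  have := Pcoer (u - v).
  have -> : P (u - v) = T u - T v + (w - Q u) - (w - Q v).
    rewrite linearB !TPQ -[RHS]addrA opprD [in RHS](addrACA (P u)).
    have -> : w - Q u - (w - Q v) = - (Q u - Q v).
      by rewrite !opprB addrC addrA subrK.
    by rewrite addrK.
  have := ler_norm (ip (T u - T v + (w - Q u) - (w - Q v)) (u - v)).
  move=> /le_trans /(_ (ip_CauchySchwarz ip_norm _ _)).
  have b : `|T u - T v + (w - Q u) - (w - Q v)| < C * e.
    rewrite (le_lt_trans (ler_normB _ _))//.
    have := ler_normD (T u - T v) (w - Q u); have := ler_normB (T u) (T v).
    lra.
  move=> h1 /le_trans /(_ h1); rewrite expr2 mulrA.
  have uv0 : 0 < `|u - v| by apply: lt_le_trans euv.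
  rewrite ler_pM2r// => h2; have := le_lt_trans h2 b.
  by rewrite ltr_pM2l// ltNge euv.
have : cvg G by exact/cauchy_cvgP.
move=> /cvg_ex[/= u Gu].
have Eu : E u.
  apply: (@closed_cvg _ _ G _ id E) => //.
  by exists 1 => //= v [[]].
have u1 : `|u| = 1.
  apply: (@norm_cvg_unique _ R^o (@Num.norm R H @ G)) => //.
    by apply: cvg_norm.
  by apply: cvg_near_cst; exists 1 => //= v [[]].
have Tu0 : T u = 0.
  apply: (@norm_cvg_unique _ H (T @ G)) => //; first exact: cvg_trans (cvg_app T Gu) (Tcont u).
  apply/cvgrPdist_lt => e e0; exists e => //= v [[_ _ Tv] _].
  by rewrite sub0r normrN.
by move: u1; rewrite (Tinj u)// normr0 => /eqP; rewrite eq_sym oner_eq0.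
Qed.
End Operators.

(** * Positive symmetric operators on an invariant subspace *)

Section Positive.
Context {R : realType} {H : completeNormedModType R} (ip : {dot H for idfun}).
Hypothesis ip_norm : norm_of_dot ip.
Variables (T : {linear H -> H}) (E : set H).
Hypotheses (Tcont : continuous T) (Tsym : forall u v, ip (T u) v = ip u (T v)).
Hypotheses (Esub : is_subspace E) (TE : forall u, E u -> E (T u)).
Hypothesis Tpos : forall u, E u -> 0 <= ip (T u) u.

Lemma positive_expansion (t : R) u : 0 <= t -> E u -> `|u| <= `|u + t *: T u|.
Proof.
move=> t0 Eu; rewrite -(@ler_pXn2r _ 2)// ?nnegrE//.
rewrite (sqr_normD ip_norm) ipE// ip_sym -addrA lerDl addr_ge0// ?sqr_ge0//.
by rewrite !mulr_ge0// Tpos.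
Qed.

(** For a bound [M] of [T], the step [t = 1 / M] works: expanding the square and using
    [|T u|^2 <= M (T u, u)] leaves at most [|u|^2 - |T u|^2 / M^2], and [T] is bounded below by
    [c]. *)
Lemma positive_contraction (c : R) :
  0 < c -> (forall u, E u -> c * `|u| <= `|T u|) ->
  exists t rho : R, [/\ 0 < t, 0 <= rho, rho < 1 &
    forall u, E u -> `|u - t *: T u| <= rho * `|u|].
Proof.
move=> c0 Tc; have [M M0 TM] := continuous_linear_bound Tcont.
(* Cauchy-Schwarz for the form of [T] at [u] and [T u] bounds [|T u|^4] by
   [(T u, u) (T (T u), T u)], whose last factor is at most [M |T u|^2]. *)
have TMq u : E u -> `|T u| ^+ 2 <= M * ip (T u) u.
  move=> Eu; have [->|Tu0] := eqVneq (T u) 0.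
    by rewrite normr0 expr0n /= ipE mulr0.
  have n0 : 0 < `|T u| ^+ 2 by rewrite exprn_gt0// normr_gt0.
  rewrite -(@ler_pM2r _ (`|T u| ^+ 2))// -expr2 -(ip_norm (T u)).
  rewrite (le_trans (psd_CauchySchwarz Tsym Esub Tpos Eu (TE Eu)))//.
  rewrite ip_norm mulrAC mulrC ler_wpM2r ?Tpos//.
  rewrite (le_trans (ler_norm _))// (le_trans (ip_CauchySchwarz ip_norm _ _))//.
  by rewrite expr2 mulrA ler_wpM2r.
(* The maximum covers a trivial [E], where [c] may exceed [M]. *)
pose k := Num.max 0 (1 - c ^+ 2 / M ^+ 2).
have k1 : k < 1 by rewrite gt_max ltr01/= gtrBl divr_gt0// exprn_gt0.
have k0 : 0 <= k by rewrite le_max lexx.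
exists M^-1, (Num.sqrt k); split => //; first by rewrite invr_gt0.
  by rewrite -sqrtr1 ltr_sqrt.
move=> u Eu; rewrite -(@ler_pXn2r _ 2)// ?nnegrE ?mulr_ge0// exprMn sqr_sqrtr//.
have : `|u - M^-1 *: T u| ^+ 2 <= (1 - c ^+ 2 / M ^+ 2) * `|u| ^+ 2.
  rewrite (sqr_normD ip_norm) normrN normrZ !ipE exprMn.
  rewrite ger0_norm ?invr_ge0 ?(ltW M0)// (ip_sym _ u).
  have h1 := TMq _ Eu.
  have h2 : c ^+ 2 * `|u| ^+ 2 <= `|T u| ^+ 2.
    by rewrite -exprMn ler_pXn2r ?nnegrE ?mulr_ge0 ?(ltW c0)// Tc.
  rewrite -(@ler_pM2l _ (M ^+ 2)) ?exprn_gt0//.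
  have -> : M ^+ 2 * (`|u| ^+ 2 + 2 * - (M^-1 * ip (T u) u) + M^-1 ^+ 2 * `|T u| ^+ 2)
    = M ^+ 2 * `|u| ^+ 2 - 2 * (M * ip (T u) u) + `|T u| ^+ 2.
    by field; rewrite gt_eqF.
  have -> : M ^+ 2 * ((1 - c ^+ 2 / M ^+ 2) * `|u| ^+ 2) =
    M ^+ 2 * `|u| ^+ 2 - c ^+ 2 * `|u| ^+ 2 by field; rewrite gt_eqF.
  lra.
by move/le_trans; apply; rewrite ler_wpM2r ?sqr_ge0// le_max lexx orbT.
Qed.

(* The solution is the fixed point of [u |-> u - t (T u - f)]. *)
Lemma positive_surjective (c : R) f :
  closed E -> 0 < c -> (forall u, E u -> c * `|u| <= `|T u|) -> E f ->
  exists2 u, E u & T u = f.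
Proof.
move=> Ecl c0 Tc Ef; have [t [rho [t0 rho0 rho1 Trho]]] := positive_contraction c0 Tc.
have [E0 Elin] := Esub.
have EB u v : E u -> E v -> E (u - v).
  by move=> Eu Ev; rewrite addrC -scaleN1r; apply: Elin.
pose g u := u - t *: (T u - f).
have gE : set_fun E E g.
  move=> u Eu; rewrite /g addrC -scaleNr; apply: Elin => //.
  by apply: EB => //; exact: TE.
pose gf : {fun E >-> E} := mkfun_fun gE.
have gctr : is_contraction gf.
  exists (NngNum rho0); split => //= -[u v] [/= Eu Ev].
  have -> : g u - g v = (u - v) - t *: T (u - v).
    rewrite /g opprD addrACA opprK [- _ + _]addrC -scalerBr opprB addrA subrK.
    by rewrite (linearB T) -scalerN opprB.
  by apply: Trho; exact: EB.
have [|u Eu gu] := banach_fixed_point gctr Ecl; first by exists 0.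
exists u => //; have /eqP : g u = u by rewrite [RHS]gu.
rewrite /g -subr_eq0 addrC addrA addNr add0r oppr_eq0 scaler_eq0 gt_eqF//=.
by rewrite subr_eq0 => /eqP.
Qed.

End Positive.

(** * The spectral splitting *)

Section Splitting.
Context {R : realType} {H : completeNormedModType R} (ip : {dot H for idfun}).
Hypothesis ip_norm : norm_of_dot ip.
Variables (T : sa_operator ip) (Hp Hm : set H).
Hypothesis split : spectral_splitting ip T Hp Hm.
Local Notation H0 := (ker_op T).

Lemma ker_subspace : is_subspace H0.
Proof.
split=> [|a u v]; rewrite /ker_op /= ?linear0// => Tu Tv.
by rewrite linearP Tu Tv scaler0 addr0.
Qed.

Lemma range_orthocomp u : orthocomp ip H0 (T u).
Proof. by move=> v Tv; rewrite sa_symmetric Tv ipE. Qed.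

Lemma split_orthmp : Hm `<=` orthocomp ip Hp.
Proof. by move=> u um v vp; rewrite ip_sym; exact: (split_orthpm split). Qed.

Lemma split_cross u0 up um :
  H0 u0 -> Hp up -> Hm um -> [/\ ip u0 up = 0, ip u0 um = 0 & ip up um = 0].
Proof.
move=> h0 hp hm; split; rewrite ?[ip u0 _]ip_sym.
- exact: (split_orthp split).
- exact: (split_orthm split).
- exact: (split_orthpm split).
Qed.

Lemma split_oproj u0 up um : H0 u0 -> Hp up -> Hm um ->
  [/\ oproj ip H0 (u0 + up + um) = u0,
      oproj ip Hp (u0 + up + um) = up &
      oproj ip Hm (u0 + up + um) = um].
Proof.
move=> h0 hp hm; split; apply: oprojE => //.
- exact: ker_subspace.
- rewrite addrC -addrA addKr => v v0.
  have [e1 e2 _] := split_cross v0 hp hm.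
  by rewrite ip_sym !ipE e1 e2 addr0.
- exact: (split_subp split).
- rewrite addrAC addrK => v vp.
  by have [_ _ e3] := split_cross h0 vp hm;
     have [e1 _ _] := split_cross h0 vp hm; rewrite !ipE e1 ip_sym e3 addr0.
- exact: (split_subm split).
- rewrite addrK => v vm.
  have [_ e2 e3] := split_cross h0 hp vm.
  by rewrite !ipE e2 e3 addr0.
Qed.

Lemma split_oproj_ker u : H0 (oproj ip H0 u).
Proof.
by have [u0 [up [um [h0 hp hm ->]]]] := split_sum split u; have [-> _ _] := split_oproj h0 hp hm.
Qed.

Lemma split_orthocomp u :
  orthocomp ip H0 u -> exists up um, [/\ Hp up, Hm um & u = up + um].
Proof.
move=> hu; have [u0 [up [um [h0 hp hm e]]]] := split_sum split u.
exists up, um; split => //; rewrite e -[RHS]add0r addrA; congr (_ + _ + _).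
apply: (ip_self0 ip_norm); have := hu _ h0; rewrite e !ipE.
by have [e1 e2 _] := split_cross h0 hp hm; rewrite (ip_sym _ up) e1 (ip_sym _ um) e2 !addr0.
Qed.

(** This yields closedness of [Hp], and later a test of membership by orthogonality alone. *)
Lemma split_plusE : Hp = orthocomp ip H0 `&` orthocomp ip Hm.
Proof.
rewrite predeqE => u; split => [hu|[h0 hm]].
  by split; [exact: (split_orthp split)|exact: (split_orthpm split)].
have [up [um [hp hm' e]]] := split_orthocomp h0.
suff um0 : um = 0 by rewrite e um0 addr0.
apply: (ip_self0 ip_norm); have := hm _ hm'; rewrite e !ipE.
by rewrite (split_orthpm split hp hm') add0r.
Qed.

Lemma split_minusE : Hm = orthocomp ip H0 `&` orthocomp ip Hp.
Proof.
rewrite predeqE => u; split => [hu|[h0 hp]].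
  by split; [exact: (split_orthm split)|exact: split_orthmp].
have [up [um [hp' hm e]]] := split_orthocomp h0.
suff up0 : up = 0 by rewrite e up0 add0r.
apply: (ip_self0 ip_norm); have := hp _ hp'; rewrite e !ipE.
by rewrite (split_orthmp hm hp') addr0.
Qed.

Lemma split_closed_plus : closed Hp.
Proof. by rewrite split_plusE; apply: closedI; apply: closed_orthocomp. Qed.

Lemma split_closed_minus : closed Hm.
Proof. by rewrite split_minusE; apply: closedI; apply: closed_orthocomp. Qed.

Lemma split_pos u : Hp u -> 0 <= ip (T u) u.
Proof.
move=> hu; have [->|u0] := eqVneq u 0; first by rewrite ipE.
exact/ltW/(split_posp split).
Qed.

Lemma split_neg u : Hm u -> 0 <= ip (- T u) u.
Proof.
move=> hu; have [->|u0] := eqVneq u 0; first by rewrite !ipE.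
by rewrite ipE oppr_ge0; exact/ltW/(split_negm split).
Qed.

(** On [Hm] the results on positive operators are applied to [-T]. *)
Let opT : {linear H -> H} := -%R \o T.

Let opT_cont : continuous opT.
Proof. by move=> u; apply: cvgN; exact: sa_continuous. Qed.

Let opT_sym u v : ip (opT u) v = ip u (opT v).
Proof. by rewrite /= !ipE sa_symmetric. Qed.

Let opT_minus u : Hm u -> Hm (opT u).
Proof.
move=> hu; have [Hm0 Hmlin] := split_subm split.
rewrite /= -[- _]addr0 -scaleN1r; apply: Hmlin => //.
by apply: (split_invm split); exists u.
Qed.

Variable c : R.
Hypothesis c0 : 0 < c.
Hypothesis Tc : forall u, orthocomp ip H0 u -> c * `|u| <= `|T u|.

Lemma split_minus_contraction : exists t rho : R, [/\ 0 < t, 0 <= rho, rho < 1 &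
    forall u, Hm u -> `|u + t *: T u| <= rho * `|u|].
Proof.
have [|t [rho [t0 r0 r1 h]]] := positive_contraction ip_norm opT_cont opT_sym
  (split_subm split) opT_minus split_neg c0.
  by move=> u /(split_orthm split)/Tc; rewrite /= normrN.
by exists t, rho; split => // u /h; rewrite /= scalerN opprK.
Qed.

Lemma split_surjective f : orthocomp ip H0 f ->
  exists2 u, orthocomp ip H0 u & T u = f.
Proof.
move=> /split_orthocomp[fp [fm [hfp hfm ->]]].
have [||up hup <-] := positive_surjective ip_norm (@sa_continuous _ _ _ T)
  (@sa_symmetric _ _ _ T) (split_subp split) _ split_pos split_closed_plus c0 _ hfp.
- by move=> u hu; apply: (split_invp split); exists u.
- by move=> u /(split_orthp split)/Tc.
have [|um hum <-] := positive_surjective ip_norm opT_cont opT_sym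
  (split_subm split) opT_minus split_neg split_closed_minus c0 _ hfm.
  by move=> u /(split_orthm split)/Tc; rewrite /= normrN.
exists (up - um); last by rewrite linearB.
rewrite addrC -scaleN1r; apply: (subspace_orthocomp ip _).2.
  exact: (split_orthm split).
exact: (split_orthp split).
Qed.

(* [N] is the inverse of [T] on the orthogonal complement of its kernel,
   extended by 0. *)
Lemma split_pseudoinverse : exists N : {linear H -> H},
  [/\ continuous N, forall u, H0 u -> N u = 0,
      forall u, orthocomp ip H0 u -> N (T u) = u &
      forall u, H0 (u - T (N u))].
Proof.
have [H00 H0lin] := ker_subspace.
have [oc0 oclin] := subspace_orthocomp ip H0.
have exN u : exists w, orthocomp ip H0 w /\ H0 (u - T w).
  have [u0 [up [um [h0 hp hm e]]]] := split_sum split u.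
  have [|w hw Tw] := @split_surjective (up + um).
    rewrite -[up]scale1r; apply: oclin; first exact: (split_orthp split).
    exact: (split_orthm split).
  by exists w; split => //; rewrite Tw e -[u0 + _ + _]addrA addrK.
have [N Nu] := choice exN.
(* Uniqueness of the chosen preimage makes the choice function linear. *)
have uniqN u w : orthocomp ip H0 w -> H0 (u - T w) -> N u = w.
  move=> hw hu; have [hN hTN] := Nu u.
  apply/eqP; rewrite -subr_eq0; apply/eqP/(orthocomp_disj (E:=H0) ip_norm).
    rewrite /ker_op /= linearB; apply: (orthocomp_disj (E:=H0) ip_norm).
      have -> : T (N u) - T w = (-1) *: (u - T (N u)) + (u - T w).
        by rewrite scaleN1r opprB addrA subrK.
      exact: H0lin.
    by rewrite -linearB; exact: range_orthocomp.
  by rewrite addrC -scaleN1r; exact: oclin.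
have Nlin : linear N.
  move=> a u v; have [hu hTu] := Nu u; have [hv hTv] := Nu v.
  apply: uniqN; first exact: oclin.
  have -> : a *: u + v - T (a *: N u + N v) = a *: (u - T (N u)) + (v - T (N v)).
    by rewrite linearP opprD addrACA scalerBr.
  exact: H0lin.
pose NL : {linear H -> H} := HB.pack N (GRing.isLinear.Build _ _ _ _ _ Nlin).
exists NL; split => [|u hu|u hu|u]; last by have [] := Nu u.
- apply/linear_bounded_continuous/linear_boundedP; exists (c^-1); split; first exact: num_real.
  move=> M cM x; have [hx hTx] := Nu x.
  rewrite (@le_trans _ _ (c^-1 * `|x|))// ?ler_wpM2r ?(ltW cM)//.
  rewrite ler_pdivlMl// (le_trans (Tc hx))//.
  rewrite -(@ler_pXn2r _ 2)// ?nnegrE//.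
  (* Pythagoras: [T (N x)] is orthogonal to the kernel component [x - T (N x)]. *)
  rewrite -[in leRHS](subrK (T (N x)) x) (sqr_normD ip_norm).
  by rewrite ip_sym (range_orthocomp _ hTx) mulr0 addr0 lerDr sqr_ge0.
- by apply: uniqN => //; rewrite linear0 subr0.
- by apply: uniqN => //; rewrite subrr.
Qed.

End Splitting.

(** * Bounded lifts *)

(* Closed graph theorem: the lift of [N] through [i] is linear with closed graph. *)
Lemma bounded_lift {R : realType} {E X : completeNormedModType R}
    {H : normedModType R} (i : {linear X -> H}) (N : {linear E -> H}) :
  continuous i -> injective i -> continuous N -> (forall e, range i (N e)) ->
  exists2 C : R, 0 < C & forall e x, i x = N e -> `|x| <= C * `|e|.
Proof.
move=> icont iinj Ncont Ni.
have exK e : exists x, i x = N e by have [x _ <-] := Ni e; exists x.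
have [K iK] := choice exK.
have KB e f : K (e - f) = K e - K f by apply: iinj; rewrite !(linearB, iK).
have KZ a e : K (a *: e) = a *: K e by apply: iinj; rewrite !(linearZ, iK).
pose F (n : nat) := [set e | `|K e| <= n%:R].
(* Baire: the sets [F n] cover [E], so the closure of one of them contains a ball. *)
have [n [x0 [r r0 Fr]]] : exists n x0, exists2 r : R, 0 < r &
    ball x0 r `<=` closure (F n).
  apply: contrapT => noball.
  suff /(_ setT) : dense (\bigcap_n ~` closure (F n)).
    case; [by exists 0|exact: openT|move=> e [_ he]].
    have := he (Num.truncn `|K e|).+1 I; apply; apply: subset_closure.
    exact/ltW/truncnS_gt.
  apply: Baire => n; split; first exact/closed_openC/closed_closure.
  move=> U [x0 Ux0] Uop.
  have /nbhs_ballP[r r0 rU] : nbhs x0 U by exact: open_nbhs_nbhs.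
  apply/set0P/eqP => UF; apply: noball; exists n, x0, r => // y /rU Uy.
  apply: contrapT => nF; suff : (set0 : set E) y by [].
  by rewrite -UF.
pose M : R := 4 * n%:R / r.
(* Rescale [e] to length [r / 2] and approximate [x0 + a *: e] and [x0] in [F n] up to [r / 8]; the
   difference errs by at most [r / 4], half the rescaled length. *)
have approx e : exists f, `|K f| <= M * `|e| /\ `|e - f| <= 2^-1 * `|e|.
  have [->|e0] := eqVneq e 0.
    exists 0; rewrite subrr normr0 !mulr0 lexx; split => //.
    by rewrite -(subrr 0) KB subrr normr0.
  have e1 : 0 < `|e| by rewrite normr_gt0.
  pose a := r / 2 / `|e|.
  have a0 : 0 < a by rewrite !divr_gt0.
  have na : `|a *: e| = r / 2 by rewrite normrZ gtr0_norm// /a divfK ?gt_eqF.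
  have nearby y : ball x0 r y -> exists2 f, `|K f| <= n%:R & `|y - f| < r / 8.
    move=> /Fr /(_ (ball y (r / 8))) [|f [Ff yf]].
      by apply: nbhsx_ballx; rewrite divr_gt0.
    by exists f => //; move: yf; rewrite -ball_normE.
  have [|f1 Kf1 f1e] := nearby (x0 + a *: e).
    by rewrite -ball_normE /= opprD addNKr normrN na ltr_pdivrMr// ltr_pMr// ltr1n.
  have [|f2 Kf2 f2e] := nearby x0; first exact: ballxx.
  exists (a^-1 *: (f1 - f2)); split.
    rewrite KZ KB normrZ gtr0_norm ?invr_gt0// ler_pdivrMl//.
    have -> : a * (M * `|e|) = n%:R + n%:R.
      by rewrite /a /M; field; rewrite !gt_eqF.
    by rewrite (le_trans (ler_normB _ _))// lerD.
  rewrite -(@ler_pM2l _ a)//.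
  rewrite -[X in X * _](gtr0_norm a0) -normrZ scalerBr scalerA divff ?gt_eqF// scale1r.
  have -> : a *: e - (f1 - f2) = (x0 + a *: e - f1) - (x0 - f2).
    by rewrite !opprB -[x0 + _ - _]addrA [RHS]addrC addrA subrK addrCA.
  have -> : a * (2^-1 * `|e|) = r / 4 by rewrite /a; field; rewrite !gt_eqF.
  by rewrite (le_trans (ler_normB _ _))//; lra.
have [g gP] := choice approx.
(* Summing the halving corrections gives [2 * M]; the added 1 keeps the constant positive when
   [n = 0]. *)
exists (2 * M + 1) => [|e x ix]; first by rewrite ltr_wpDl// !mulr_ge0// invr_ge0 ltW.
have -> : x = K e by apply: iinj; rewrite ix iK.
(* [s k] is the residual after [k] corrections; the lifted corrections [u k] sum to a lift of
   [e - s k]. *)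
pose s k := iter k (fun y => y - g y) e.
have sk k : `|s k| <= 2^-1 ^+ k * `|e|.
  elim: k => [|k IH]; first by rewrite mul1r.
  rewrite exprS -mulrA (le_trans (gP (s k)).2)// ler_wpM2l//.
pose u k := K (g (s k)).
have uk k : `|u k| <= M * `|e| * 2^-1 ^+ k.
  rewrite (le_trans (gP (s k)).1)// -mulrA [`|e| * _]mulrC ler_wpM2l//.
  by rewrite !mulr_ge0// invr_ge0 ltW.
have Su k : i (series u k) = N e - N (s k).
  elim: k => [|k IH]; first by rewrite /series/= big_geq// linear0 subrr.
  rewrite seriesSr linearD IH /u iK /s iterS -/(s k) [N (_ - _)]linearB.
  by rewrite opprD opprK addrA.
have Sle k : `|series u k| <= 2 * M * `|e| * (1 - 2^-1 ^+ k).
  elim: k => [|k IH]; first by rewrite /series/= big_geq// normr0 subrr mulr0.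
  rewrite seriesSr (le_trans (ler_normD _ _))//.
  rewrite (le_trans (lerD IH (uk k)))// exprS le_eqVlt; apply/orP; left; apply/eqP.
  by field.
have Scvg : cvgn (series u).
  apply: normed_cvg; apply: (series_le_cvg _ _ uk).
  - by move=> k; exact: normr_ge0.
  - by move=> k; rewrite (le_trans _ (uk k)).
  - by apply: is_cvg_geometric_series; rewrite ger0_norm ?invr_ge0// invf_lt1// ltr1n.
move: Scvg => /cvg_ex[/= l Sl].
(* Closedness of the graph: continuity of [i] and [N] identifies the limit of the partial sums. *)
have il : i l = N e.
  apply: (@norm_cvg_unique _ H ((i \o series u) @ \oo)) => //.
    by apply: continuous_cvg => //; exact: icont.
  rewrite (_ : i \o series u = (fun k => N e - N (s k))); last exact/funext.
  have s0 : s @ \oo --> (0 : E).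
    apply: norm_cvg0; apply: (@squeeze_cvgr _ _ _ _ (cst 0) (geometric `|e| 2^-1)).
    - by apply: nearW => k; rewrite normr_ge0/= mulrC.
    - exact: cvg_cst.
    - by apply: cvg_geometric; rewrite ger0_norm ?invr_ge0// invf_lt1// ltr1n.
  suff : (N e - N (s k)) @[k --> \oo] --> N e - N 0 by rewrite linear0 subr0.
  by apply: cvgB; [exact: cvg_cst|exact: cvg_trans (cvg_app N s0) (Ncont 0)].
have -> : K e = l by apply: iinj; rewrite iK.
apply: (@le_trans _ _ (2 * M * `|e|)); last by rewrite ler_wpM2r// lerDl.
apply: (@closed_cvg _ _ \oo _ (series u) [set x | `|x| <= 2 * M * `|e|]) => //.
  rewrite (_ : mkset _ = (fun x : X => `|x|) @^-1` [set y | y <= 2 * M * `|e|])//.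
  apply: closed_comp => [y _|]; first exact: norm_continuous.
  exact: closed_le.
apply: nearW => k; rewrite /= (le_trans (Sle k))// ler_piMr//.
by rewrite !mulr_ge0// invr_ge0 ltW.
Qed.

(** * Admissible tuples *)

Lemma strictly_differentiable0P {R : realType} {E1 E2 : normedModType R}
    (T : E1 -> E2) : strictly_differentiable T 0 ->
  exists2 T' : {linear E1 -> E2}, forall u, 'D_u T 0 = T' u &
    forall e : R, 0 < e -> exists2 r, 0 < r & forall x y, `|x| < r -> `|y| < r ->
      `|T x - T y - T' (x - y)| <= e * `|x - y|.
Proof.
move=> [T' _ T'P]; exists T'; last first.
  move=> e /T'P[[U V] /= [/nbhs_norm0P[a a0 aU] /nbhs_norm0P[b b0 bV]] UV].
  exists (Num.min a b) => [|x y]; first by rewrite lt_min a0.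
  rewrite !lt_min => /andP[xa _] /andP[_ yb].
  by apply: (UV (x, y)); split; [exact: aU|exact: bV].
move=> u; apply: cvg_lim => //; apply/cvgrPdist_le => e e0.
(* The error at [h *: u], divided by [|h|], is at most this constant times [|u|]; adding 1 allows
   [u = 0]. *)
have d0 : 0 < e / (`|u| + 1) by rewrite divr_gt0// ltr_wpDl.
have [[U V] /= [/nbhs_norm0P[a a0 aU] nV] UV] := T'P _ d0.
near=> h.
have h0 : h != 0 by near: h; exact: nbhs_dnbhs_neq.
have hu : `|h *: u| < a.
  rewrite normrZ (@le_lt_trans _ _ (`|h| * (`|u| + 1)))//.
    by rewrite ler_wpM2l// lerDl.
  rewrite -ltr_pdivlMr ?ltr_wpDl//; near: h; apply: dnbhs0_lt.
  by rewrite divr_gt0// ltr_wpDl.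
have := UV (h *: u, 0) (conj (aU _ hu) (nbhs_singleton nV)).
rewrite /= subr0 linearZ addr0 => hA.
have -> : T' u - h^-1 *: (T (h *: u) - T 0) =
    - (h^-1 *: (T (h *: u) - T 0 - h *: T' u)).
  by rewrite [in RHS]scalerBr scalerA mulVf// scale1r opprB.
rewrite normrN normrZ normfV ler_pdivrMl ?normr_gt0// (le_trans hA)//.
rewrite normrZ mulrCA ler_wpM2l// -mulrA ler_piMr ?(ltW e0)// mulrC.
by rewrite ler_pdivrMr ?ltr_wpDl// mul1r lerDl.
Unshelve. all: by end_near. Qed.

(** Otherwise the vectors not orthogonal to [u - w] form a nonempty open set, which meets the dense
    range. *)
Lemma dense_ip_eq {R : realType} {H X : completeNormedModType R}
    (ip : {dot H for idfun}) (i : X -> H) u w : norm_of_dot ip ->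
  dense (range i) -> (forall x, ip u (i x) = ip w (i x)) -> u = w.
Proof.
move=> ipn di uw; apply/eqP; rewrite -subr_eq0; apply/negPn/negP => n0.
have [||y [/= yn [x _ xy]]] := di [set v | ip v (u - w) != 0].
- by exists (u - w); rewrite /= ipn sqrf_eq0 normr_eq0.
- apply: (@open_comp _ _ (ip ^~ (u - w)) [set y | y != 0]) => [v _|].
    exact: continuous_ip.
  exact: open_neq.
- by move: yn; rewrite -xy ip_sym !ipE uw subrr eqxx.
Qed.

Section Admissible.
Context {R : realType} {H X : completeNormedModType R}.
Variables (ip : {dot H for idfun}) (i : {linear X -> H}) (V : set H).
Variables (L : H -> R) (A : X -> X) (B : X -> sa_operator ip).
Variables (P Q : X -> {linear H -> H}) (Hp Hm : set H).
Hypothesis adm : admissible i V L A B P Q.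
Hypothesis split : spectral_splitting ip (B 0) Hp Hm.
Local Notation H0 := (ker_op (B 0)).

Lemma adm_V0 : V (i 0).
Proof. by rewrite linear0; exact: adm_S_0 adm. Qed.

Lemma adm_incl_continuous : continuous i.
Proof.
apply/linear_bounded_continuous/linear_boundedP; exists 1; split => // M M1 x.
by rewrite (le_trans (adm_S_norm adm x))// ler_peMl// ltW.
Qed.

(** (D4) along the constant sequence 0 makes [P 0] coercive, and [Q 0] is compact. *)
Lemma adm_bounded_below : exists2 c : R, 0 < c &
  forall u, orthocomp ip H0 u -> c * `|u| <= `|B 0 u|.
Proof.
have ipn := adm_S_dot adm.
have [||C [n [C0 PC]]] := adm_D4 adm (x := fun=> 0).
- by move=> _; exact: adm_V0.
- by rewrite linear0 normr0; exact: cvg_cst.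
apply: (fredholm_bounded_below ipn (P := P 0) (Q := Q 0) (C := C)) => //.
- exact: sa_continuous.
- by move=> u; apply: (adm_D adm); exact: adm_V0.
- by move=> u; exact: (PC u n).
- by apply: (adm_D_cpt adm); exact: adm_V0.
- exact: closed_orthocomp.
- exact: subspace_orthocomp.
- by move=> u hu Bu; apply: (orthocomp_disj ipn (E := H0)).
Qed.

Lemma adm_ker_range u : H0 u -> range i u.
Proof. by move=> Bu; apply: (adm_C2 adm); exists 0 => //; rewrite linear0 Bu. Qed.

(** Turns smallness in [H] into smallness in [X]: the projection [I - B(0) N] onto the kernel takes
    values in [X], so its lift is bounded. *)
Lemma adm_ker_norm : exists2 D : R, 0 < D &
  forall x, H0 (i x) -> `|x| <= D * `|i x|.
Proof.
have ipn := adm_S_dot adm.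
have [c c0 Bc] := adm_bounded_below.
have [N [Ncont NH0 NB BN]] := split_pseudoinverse ipn split c0 Bc.
pose P0 : {linear H -> H} := idfun \- (B 0 \o N).
have P0cont : continuous P0.
  move=> u; apply: cvgB; first exact: cvg_id.
  by apply: continuous_comp; [exact: Ncont|exact: sa_continuous].
have [|D D0 iD] := bounded_lift adm_incl_continuous (adm_S_inj adm) P0cont.
  by move=> u; exact/adm_ker_range/BN.
by exists D => // x hx; apply: iD; rewrite /= NH0// linear0 subr0.
Qed.

(* Apply the pseudo-inverse of [B 0] to the difference of the two equations
   [(I - P^0) A (x + y) = 0]; it maps [X] continuously to [X]. *)
Lemma adm_local_lipschitz : exists2 r : R, 0 < r & forall x1 x2 y1 y2 : X,
  `|x1| < r -> `|x2| < r -> `|y1| < r -> `|y2| < r ->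
  H0 (i x1) -> H0 (i x2) ->
  orthocomp ip H0 (i y1) -> orthocomp ip H0 (i y2) ->
  H0 (i (A (x1 + y1))) -> H0 (i (A (x2 + y2))) -> `|y1 - y2| <= `|x1 - x2|.
Proof.
have ipn := adm_S_dot adm.
have [c c0 Bc] := adm_bounded_below.
have [N [Ncont NH0 NB BN]] := split_pseudoinverse ipn split c0 Bc.
have [T' DT' T'P] := strictly_differentiable0P (adm_F2_strict adm).
have iT' u : i (T' u) = B 0 (i u).
  apply: (dense_ip_eq ipn (adm_S_dense adm)) => v.
  by rewrite -DT' (adm_F3 adm)//; exact: adm_V0.
pose Ni : {linear X -> H} := N \o i.
have Nicont : continuous Ni.
  by move=> x; apply: continuous_comp; [exact: adm_incl_continuous|exact: Ncont].
(* [B 0 (N (i x))] differs from [i x] by a kernel element, so it lies in [X], and (C2) puts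
   [N (i x)] in [X]. *)
have [|C C0 iC] := bounded_lift adm_incl_continuous (adm_S_inj adm) Nicont.
  move=> x; apply: (adm_C2 adm).
  have [z _ iz] := adm_ker_range (BN (i x)).
  by exists (x - z) => //; rewrite linearB iz /= opprB addrC subrK.
(* With this tolerance [|y1 - y2|] is at most half of [|x1 - x2| + |y1 - y2|], and the second term
   is absorbed. *)
have [|r r0 rT] := T'P (2 * C)^-1; first by rewrite invr_gt0 mulr_gt0.
exists (r / 2) => [|x1 x2 y1 y2 hx1 hx2 hy1 hy2 kx1 kx2 oy1 oy2 kA1 kA2].
  by rewrite divr_gt0.
have ltr (x y : X) : `|x| < r / 2 -> `|y| < r / 2 -> `|x + y| < r.
  by move=> hx hy; rewrite (le_lt_trans (ler_normD x y))// [r]splitr ltrD.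
set s1 := x1 + y1; set s2 := x2 + y2.
have es : s1 - s2 = (x1 - x2) + (y1 - y2) by rewrite /s1 /s2 opprD addrACA.
have := rT s1 s2 (ltr _ _ hx1 hy1) (ltr _ _ hx2 hy2).
set rem := A s1 - A s2 - T' (s1 - s2) => hrem.
(* [N] kills both values of [A], which lie in the kernel, and inverts [B 0] on [y1 - y2]. *)
have : i (y2 - y1) = Ni rem.
  have kx : B 0 (i (x1 - x2)) = 0 by rewrite !linearB kx1 kx2 subrr.
  have oy : orthocomp ip H0 (i (y1 - y2)).
    by rewrite linearB addrC -scaleN1r; exact: (subspace_orthocomp _ _).2.
  have irem : i rem = i (A s1) - i (A s2) - B 0 (i (y1 - y2)).
    by rewrite /rem 2!(linearB i) iT' es (linearD i) (linearD (B 0)) kx add0r.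
  rewrite /= irem 2!(linearB N) (NH0 _ kA1) (NH0 _ kA2) (NB _ oy) subrr sub0r.
  by rewrite -linearN opprB.
move=> /iC; rewrite distrC => /le_trans/(_ (ler_wpM2l (ltW C0) hrem)).
have -> : C * ((2 * C)^-1 * `|s1 - s2|) = `|s1 - s2| / 2.
  by field; rewrite gt_eqF.
by have := ler_normD (x1 - x2) (y1 - y2); rewrite -es; lra.
Qed.

(* [|h (t z)|] moves by small steps in [t]: as long as it is below the radius of
   the local Lipschitz estimate, the estimate bounds it by half that radius. *)
Lemma adm_h_bound : exists2 eps0 : R, 0 < eps0 & forall eps h, eps < eps0 ->
  is_h ip i A (B 0) eps h ->
  forall x, subball H0 eps (i x) -> `|h (i x)| <= `|x|.
Proof.
have [r r0 rP] := adm_local_lipschitz.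
have [D D0 iD] := adm_ker_norm.
exists (r / 2 / D) => [|eps h epslt hh x [kx xeps]]; first by rewrite !divr_gt0.
have kA y : subball H0 eps (i y) -> H0 (i (A (y + h (i y)))).
  move=> /(h_eq hh)/eqP; rewrite subr_eq0 => /eqP ->.
  exact: (split_oproj_ker (adm_S_dot adm) split).
have [H00 H0lin] := ker_subspace (B 0).
have xr : `|x| < r / 2.
  rewrite (le_lt_trans (iD _ kx))// mulrC -ltr_pdivlMr//.
  exact: lt_trans xeps epslt.
have ball0 : subball H0 eps (i 0).
  by rewrite linear0; split=> //=; rewrite normr0 (le_lt_trans _ xeps).
have ballt (t : R) : 0 <= t -> t <= 1 -> subball H0 eps (i (t *: x)).
  move=> t0 t1; rewrite linearZ_LR; split; first by rewrite -[_ *: _]addr0; exact: H0lin.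
  by rewrite /= normrZ ger0_norm// (le_lt_trans _ xeps)// ler_piMl.
(* Comparison with the solution [h 0 = 0] over the origin. *)
have bound (t : R) : 0 <= t -> t <= 1 -> `|h (i (t *: x))| < r -> `|h (i (t *: x))| <= `|x|.
  move=> t0 t1 hr; have ht := ballt t t0 t1.
  have tx : `|t *: x| <= `|x| by rewrite normrZ ger0_norm// ler_piMl.
  have h0 : h (i 0) = 0 by rewrite linear0 (h_0 hh).
  have := rP (t *: x) 0 (h (i (t *: x))) (h (i 0)).
  rewrite h0 !subr0 => /(_ _ _ _ _ _ _ _ _ _ _)/le_trans; apply => //.
  - by rewrite (le_lt_trans tx)// (lt_trans xr)// ltr_pdivrMr// ltr_pMr// ltr1n.
  - by rewrite normr0.
  - by rewrite normr0.
  - by case: ht.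
  - by rewrite linear0.
  - exact: (h_Xpm hh).
  - by rewrite linear0; exact: (subspace_orthocomp _ _).1.
  - exact: kA.
  - by have := kA _ ball0; rewrite h0.
have /pinfty_ex_gt0[M M0 hM] := h_lipschitz hh.
(* Enough steps for each Lipschitz increment of [h] to stay below [r / 2]. *)
pose n := (Num.truncn (M * `|i x| / (r / 2))).+1.
have n0 : 0 < n%:R :> R by rewrite ltr0n.
have Mn : M * (n%:R^-1 * `|i x|) < r / 2.
  have : M * `|i x| / (r / 2) < n%:R by exact: truncnS_gt.
  by rewrite ltr_pdivrMr ?divr_gt0// => Mn; rewrite mulrCA ltr_pdivrMl.
suff step k : (k <= n)%N -> `|h (i ((k%:R / n%:R) *: x))| <= `|x|.
  by have := step n (leqnn n); rewrite divff ?gt_eqF// scale1r.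
elim: k => [_|k IH kn]; first by rewrite mul0r scale0r linear0 (h_0 hh) normr0.
have tb j : (j <= n)%N -> 0 <= j%:R / n%:R :> R /\ j%:R / n%:R <= 1 :> R.
  by move=> jn; rewrite divr_ge0// ler_pdivrMr// mul1r ler_nat.
have [t0 t1] := tb _ kn; have [s0 s1] := tb _ (ltnW kn).
apply: bound => //.
have /= := hM (i ((k.+1%:R / n%:R) *: x), i ((k%:R / n%:R) *: x))
  (conj (ballt _ t0 t1) (ballt _ s0 s1)).
rewrite -linearB -scalerBl -mulrBl -natrB// subSnn div1r linearZ_LR normrZ ger0_norm ?invr_ge0//.
move=> hst; rewrite -[X in `|X|](subrK (h (i ((k%:R / n%:R) *: x)))).
rewrite (le_lt_trans (ler_normD _ _))// [r]splitr ltrD//.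
  exact: le_lt_trans hst Mn.
exact: le_lt_trans (IH (ltnW kn)) xr.
Qed.

End Admissible.

(** * Isometries intertwining two splittings *)

Section Intertwining.
Context {R : realType} {H H' : completeNormedModType R}.
Variables (ip : {dot H for idfun}) (ip' : {dot H' for idfun}).
Hypotheses (ip_norm : norm_of_dot ip) (ip_norm' : norm_of_dot ip').
Variables (T : sa_operator ip) (T' : sa_operator ip') (Hp Hm : set H) (Hp' Hm' : set H').
Hypothesis split : spectral_splitting ip T Hp Hm.
Hypothesis split' : spectral_splitting ip' T' Hp' Hm'.
Variable J : {linear H -> H'}.
Hypothesis J_isom : forall u v, ip' (J u) (J v) = ip u v.
Hypothesis J_T : forall u, T' (J u) = J (T u).

Lemma isom_norm u : `|J u| = `|u|.
Proof.
by apply/eqP; rewrite -(@eqrXn2 _ 2)// -ip_norm' -ip_norm J_isom.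
Qed.

Lemma isom_ker u : ker_op T u -> ker_op T' (J u).
Proof. by rewrite /ker_op /= J_T => ->; rewrite linear0. Qed.

Variable c : R.
Hypothesis c0 : 0 < c.
Hypothesis Tc : forall u, orthocomp ip (ker_op T) u -> c * `|u| <= `|T u|.

Lemma isom_orthocomp u :
  orthocomp ip (ker_op T) u -> orthocomp ip' (ker_op T') (J u).
Proof.
by move=> /(split_surjective ip_norm split c0 Tc)[w _ <-]; rewrite -J_T; exact: range_orthocomp.
Qed.

(* [I + t T] contracts [Hm], while [I + t T'] expands [Hp'] and commutes with the
   projection of [H'] onto [Hp']; iterating, the [Hp']-component of [J u] is 0. *)
Lemma isom_minus u : Hm u -> Hm' (J u).
Proof.
have [t [rho [t0 rho0 rho1 Trho]]] := split_minus_contraction ip_norm split c0 Tc.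
have [Hp'0 Hp'lin] := split_subp split'; have [Hm'0 Hm'lin] := split_subm split'.
(* The vector varies in the induction: the step passes to [u + t *: T u], whose image splits by
   applying [I + t T'] to [up] and [um]. *)
have decay k : forall u up um, Hm u -> Hp' up -> Hm' um -> J u = up + um ->
    `|up| <= rho ^+ k * `|u|.
  elim: k => [|k IH] {}u up um hu hup hum Ju.
    rewrite mul1r -isom_norm Ju -(@ler_pXn2r _ 2)// ?nnegrE//.
    by rewrite (sqr_normD ip_norm') (split_orthpm split' hup hum) mulr0 addr0 lerDl sqr_ge0.
  have Tup : Hp' (T' up) by apply: (split_invp split'); exists up.
  have Tum : Hm' (T' um) by apply: (split_invm split'); exists um.
  have expand : `|up| <= `|up + t *: T' up|.
    apply: (positive_expansion ip_norm' (E := Hp')) => //; last exact: ltW.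
    by move=> v; exact: (split_pos split').
  rewrite (le_trans expand)// (le_trans (IH (u + t *: T u) _ (um + t *: T' um) _ _ _ _))//.
  - rewrite addrC; apply: (split_subm split).2 => //.
    by apply: (split_invm split); exists u.
  - by rewrite addrC; exact: Hp'lin.
  - by rewrite addrC; exact: Hm'lin.
  - rewrite linearD linearZ_LR -J_T Ju (linearD T') scalerDr.
    by rewrite addrACA.
  - by rewrite exprSr -mulrA ler_wpM2l ?exprn_ge0// Trho.
move=> hu; have [up [um [hup hum Ju]]] :=
  split_orthocomp ip_norm' split' (isom_orthocomp (split_orthm split hu)).
suff up0 : up = 0 by rewrite Ju up0 add0r.
apply/eqP; rewrite -normr_le0.
have lim0 : (rho ^+ k * `|u|) @[k --> \oo] --> (0 : R).
  rewrite -(mul0r `|u|); apply: cvgMl.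
  by apply: cvg_expr; rewrite ger0_norm.
rewrite -(cvg_lim _ lim0)//; apply: limr_ge; first by apply/cvg_ex; exists 0.
by apply: nearW => k; exact: decay Ju.
Qed.

(** In coordinates [J] becomes an injective endomorphism of row vectors of length [n], hence an
    invertible square matrix. *)
Lemma isom_minus_onto n v : has_dim Hm n -> has_dim Hm' n -> Hm' v ->
  exists2 u, Hm u & J u = v.
Proof.
move=> [f finj fr] [f' f'inj fr'].
have exg x : exists y, f' y = J (f x).
  have : Hm' (J (f x)) by apply: isom_minus; rewrite -fr; exists x.
  by rewrite -fr' => -[y _ ?]; exists y.
have [g gP] := choice exg.
have glin : linear g.
  by move=> a x y; apply: f'inj; rewrite linearP !gP !linearP.
pose gL : {linear 'rV[R]_n -> 'rV[R]_n} := HB.pack g (GRing.isLinear.Build _ _ _ _ _ glin).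
pose M := lin1_mx gL.
have Mfree : row_free M.
  apply: inj_row_free => x; rewrite mul_rV_lin1 /= => gx0.
  apply: finj; rewrite linear0; apply/eqP; rewrite -normr_eq0 -isom_norm -gP gx0.
  by rewrite linear0 normr0.
rewrite -fr' => -[y _ <-]; exists (f (y *m invmx M)).
  by rewrite -fr; exists (y *m invmx M).
rewrite -gP -[g _]/(gL _) -mul_rV_lin1 -/M mulmxKV//.
by rewrite -row_free_unit.
Qed.

(** Orthogonality to [Hm'] is tested on vectors [J w] with [w] in [Hm], which exhaust [Hm']. *)
Lemma isom_plus n u : has_dim Hm n -> has_dim Hm' n -> Hp u -> Hp' (J u).
Proof.
move=> dHm dHm' hu; rewrite (split_plusE ip_norm' split'); split.
  exact/isom_orthocomp/(split_orthp split).
move=> v /(isom_minus_onto dHm dHm')[w hw <-].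
by rewrite J_isom (split_orthpm split).
Qed.

End Intertwining.

(** * Transport of the construction by the isometry *)

Theorem theorem6p1 (R : realType)
    (H X : completeNormedModType R) (ip : {dot H for idfun}) (i : {linear X -> H})
    (V : set H) (L : H -> R) (A : X -> X) (B : X -> sa_operator ip)
    (P Q : X -> {linear H -> H}) (Hp Hm : set H)
    (adm : admissible i V L A B P Q)
    (split : spectral_splitting ip (B 0) Hp Hm)
    (H' X' : completeNormedModType R) (ip' : {dot H' for idfun}) (i' : {linear X' -> H'})
    (V' : set H') (L' : H' -> R) (A' : X' -> X') (B' : X' -> sa_operator ip')
    (P' Q' : X' -> {linear H' -> H'}) (Hp' Hm' : set H')
    (adm' : admissible i' V' L' A' B' P' Q')
    (split' : spectral_splitting ip' (B' 0) Hp' Hm')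
    (J : {linear H -> H'}) (JX : {linear X -> X'})
    (J_inj : injective J)
    (J_isom : forall u v, ip' (J u) (J v) = ip u v)
    (J_X : forall x, i' (JX x) = J (i x))
    (JX_cont : continuous JX)
    (J_L : forall u, L' (J u) = L u)
    (J_A : forall x, A' (JX x) = JX (A x))
    (J_B : forall x u, B' (JX x) (J u) = J (B x u))
    (n : nat) (dim_Hm : has_dim Hm n) (dim_Hm' : has_dim Hm' n) :
  exists2 delta0 : R, 0 < delta0 & forall delta : R, 0 < delta < delta0 ->
  exists2 eps10 : R, 0 < eps10 < delta & forall eps1 : R, 0 < eps1 < eps10 ->
  exists2 eps0 : R, 0 < eps0 & forall eps : R, 0 < eps < eps0 ->
  forall (h : H -> X) (vphi phi : H -> H -> H)
         (h' : H' -> X') (vphi' phi' : H' -> H' -> H'),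
    construction ip i L A (B 0) Hp Hm delta eps1 eps h vphi phi ->
    construction ip' i' L' A' (B' 0) Hp' Hm' delta eps1 eps h' vphi' phi' ->
  forall z up um,
    subball (ker_op (B 0)) eps z -> subball Hp eps up -> subball Hm eps um ->
    [/\ h' (J z) = JX (h z),
        Phi i' h' phi' (J z) (J up + J um) = J (Phi i h phi z (up + um)),
        L' (Phi i' h' phi' (J z) (J up + J um)) = L (Phi i h phi z (up + um))
      & L' (J z + i' (h' (J z))) = L (z + i (h z))].
Proof.
have ipn := adm_S_dot adm; have ipn' := adm_S_dot adm'.
have [c c0 Bc] := adm_bounded_below adm.
have J_T u : B' 0 (J u) = J (B 0 u) by rewrite -J_B linear0.
have J_norm := isom_norm ipn ipn' J_isom.
have J_ker u : ker_op (B 0) u -> ker_op (B' 0) (J u) by exact: isom_ker.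
have J_ortho := isom_orthocomp ipn split J_T c0 Bc.
have J_minus := isom_minus ipn ipn' split split' J_isom J_T c0 Bc.
have J_onto v := isom_minus_onto ipn ipn' split split' J_isom J_T c0 Bc (v := v) dim_Hm dim_Hm'.
have J_plus u := isom_plus ipn ipn' split split' J_isom J_T c0 Bc (u := u) dim_Hm dim_Hm'.
have [D D0 kerD] := adm_ker_norm adm split.
have [e1 e10 hbound] := adm_h_bound adm split.
have [e2 e20 hbound'] := adm_h_bound adm' split'.
have [r r0 lip'] := adm_local_lipschitz adm' split'.
have [M M0 JXM] := continuous_linear_bound JX_cont.
exists 1 => // delta /andP[delta0 _].
exists (delta / 2) => [|eps1 _]; first by rewrite divr_gt0//= ltr_pdivrMr// ltr_pMr// ltr1n.
(* [e1] and [e2] control [h] and [h']; the last bound gives [M * D * eps < r], which puts all points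
   compared below in the uniqueness ball of the second tuple. *)
exists (Num.min (Num.min e1 e2) (r / M / D)) => [|eps /andP[eps0]].
  by rewrite !lt_min e10 e20 !divr_gt0.
rewrite !lt_min => /andP[/andP[epse1 epse2] epsr].
move=> h vphi phi h' vphi' phi' [hh hvphi hphi] [hh' hvphi' hphi'].
have J_ball0 z : subball (ker_op (B 0)) eps z -> subball (ker_op (B' 0)) eps (J z).
  by move=> [kz zeps]; split; [exact: J_ker|rewrite /= J_norm].
have J_ballp e u : subball Hp e u -> subball Hp' e (J u).
  by move=> [hu ue]; split; [exact: J_plus|rewrite /= J_norm].
have J_ballm e u : subball Hm e u -> subball Hm' e (J u).
  by move=> [hu ue]; split; [exact: J_minus|rewrite /= J_norm].
have J_ballm_onto e v : subball Hm' e v -> exists2 u, subball Hm e u & J u = v.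
  move=> [/J_onto[u hu <-]]; rewrite /= J_norm => ue.
  by exists u.
(* [h' (J z)] and [JX (h z)] solve the second equation over the same point [JX x], so the Lipschitz
   estimate bounds their difference by 0. *)
have J_h z : subball (ker_op (B 0)) eps z -> h' (J z) = JX (h z).
  move=> bz; have [x _ xz] := adm_ker_range adm (proj1 bz); subst z.
  have bJz := J_ball0 _ bz; rewrite -J_X in bJz *.
  have JXr y : `|y| <= `|x| -> `|JX y| < r.
    move=> yx; rewrite (le_lt_trans (JXM y))// mulrC -ltr_pdivlMr//.
    rewrite (le_lt_trans yx)// (le_lt_trans (kerD x (proj1 bz)))//.
    by rewrite mulrC -ltr_pdivlMr// (lt_trans (proj2 bz)).
  apply/eqP; rewrite -subr_eq0 -normr_le0.
  rewrite (le_trans (lip' (JX x) (JX x) _ _ _ _ _ _ _ _ _ _ _ _)) ?subrr ?normr0//.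
  - exact: JXr.
  - exact: JXr.
  - exact: le_lt_trans (hbound' _ _ epse2 hh' _ bJz) (JXr x (lexx _)).
  - exact/JXr/(hbound _ _ epse1 hh).
  - by case: bJz.
  - by case: bJz.
  - exact: (h_Xpm hh').
  - by rewrite J_X; apply/J_ortho/(h_Xpm hh).
  - have /eqP := h_eq hh' bJz; rewrite subr_eq0 => /eqP ->.
    exact: (split_oproj_ker ipn' split').
  - rewrite -linearD J_A J_X; apply: J_ker.
    have /eqP := h_eq hh bz; rewrite subr_eq0 => /eqP ->.
    exact: (split_oproj_ker ipn split).
have J_F z u : subball (ker_op (B 0)) eps z ->
    Ffun i' L' h' (J z) (J u) = Ffun i L h z u.
  by move=> bz; rewrite /Ffun J_h// J_X -!linearD !J_L.
(* [J] maps the ball of [Hm] onto that of [Hm'], so the transported maximizer beats every competitor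
   there. *)
have J_vphi z xp : subball (ker_op (B 0)) eps z -> subball Hp eps1 xp ->
    vphi' (J z) (J xp) = J (vphi z xp).
  move=> bz bxp; have [[hm hmax] _] := hvphi _ _ bz bxp.
  have [_ uniq] := hvphi' _ _ (J_ball0 _ bz) (J_ballp _ _ bxp).
  apply/esym/uniq; split; first exact: J_ballm.
  by move=> _ /J_ballm_onto[xm bxm <-]; rewrite -!linearD !J_F//; exact: hmax.
have J_oprojp xp xm : Hp xp -> Hm xm ->
  [/\ oproj ip Hp (xp + xm) = xp, oproj ip Hm (xp + xm) = xm,
      oproj ip' Hp' (J (xp + xm)) = J xp & oproj ip' Hm' (J (xp + xm)) = J xm].
  move=> hp hm; have [k0 _] := ker_subspace (B 0); have [k0' _] := ker_subspace (B' 0).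
  have [_ e1' e2'] := split_oproj ipn split k0 hp hm.
  have [_ e3 e4] := split_oproj ipn' split' k0' (J_plus _ hp) (J_minus _ hm).
  by rewrite !add0r in e1' e2' e3 e4; rewrite linearD; split.
have J_psi z x : subball (ker_op (B 0)) eps z -> ball_sum Hp Hm eps1 delta x ->
    psi ip' i' L' Hp' Hm' h' vphi' (J z) (J x) = J (psi ip i L Hp Hm h vphi z x).
  move=> bz [xp bxp [xm bxm <-]].
  have [e1' e2' e3 e4] := J_oprojp _ _ (proj1 bxp) (proj1 bxm).
  (* The coefficients agree because [J] preserves [Ffun] and norms; linearity does the rest. *)
  rewrite /psi e1' e2' e3 e4 J_vphi// -!(linearD J) -(linearB J) !J_F// !J_norm.
  by rewrite [RHS]linearD !linearZ_LR.
have J_phi z u : subball (ker_op (B 0)) eps z -> ball_sum Hp Hm eps eps u ->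
    phi' (J z) (J u) = J (phi z u).
  move=> bz bu; have [[bphi psiphi] _] := hphi _ _ bz bu.
  have [|_ uniq] := hphi' _ (J u) (J_ball0 _ bz).
    case: bu => up bup [um bum <-]; exists (J up); first exact: J_ballp.
    by exists (J um); [exact: J_ballm|rewrite linearD].
  apply/esym/uniq; split; last by rewrite J_psi// psiphi.
  case: bphi => xp bxp [xm bxm <-]; exists (J xp); first exact: J_ballp.
  by exists (J xm); [exact: J_ballm|rewrite linearD].
move=> z up um bz bup bum.
have J_Phi : Phi i' h' phi' (J z) (J up + J um) = J (Phi i h phi z (up + um)).
  rewrite /Phi J_h// J_X -linearD J_phi -?linearD//.
  by exists up => //; exists um.
by split; rewrite ?J_Phi ?J_h// J_X -linearD.
Qed.
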